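(* Let $\alpha>2$, $\beta>0$, $p\in[1,2]$, and let $J_\alpha:\mathbb{N}_{\ge 1}\to\mathbb{R}$ satisfy $J_\alpha(k)\sim k^{-\alpha}$ as $k\to\infty$ (positivity of $J_\alpha$ is not assumed). Put $J_{ij}=J_\alpha(|i-j|)$ for $i\neq j\in\mathbb{Z}$ and $V(x)=|x|^p$, and consider the $\mathbb{Z}$-valued field $\phi=(\phi_i)_{i\in\mathbb{Z}}\in\mathbb{Z}^{\mathbb{Z}}$ at inverse temperature $\beta$ with formal Hamiltonian $$H(\phi)=\sum_{i\neq j\in\mathbb{Z}}J_{ij}\,V(\phi_i-\phi_j).$$ Let $\mathcal{G}_{si}$ denote the set of shift-invariant Gibbs measures on $\mathbb{Z}^{\mathbb{Z}}$ for $H$ at inverse temperature $\beta$. Then: (1) If $p\in\{1,2\}$, there does not exist any $\mu\in\mathcal{G}_{si}$ such that $\langle|\phi_0|\rangle_\mu<\infty$. (2) If $p\in(1,2)$, there does not exist any $\mu\in\mathcal{G}_{si}$ such that $\langle\phi_0^2\rangle_\mu<\infty$.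
   Context: Notation: $\langle\cdot\rangle_\nu$ denotes expectation under a probability measure $\nu$ on $\Omega=\mathbb{Z}^{\mathbb{Z}}$ (with the product $\sigma$-algebra). $J_\alpha(k)\sim k^{-\alpha}$ means $k^{\alpha}J_\alpha(k)\to1$ as $k\to\infty$. $\Lambda\Subset\mathbb{Z}$ means that $\Lambda$ is a finite subset of $\mathbb{Z}$. Finite-volume measures: for $\Lambda\Subset\mathbb{Z}$ and a boundary condition $\omega\in\mathbb{Z}^{\mathbb{Z}}$, $\mu^\omega_\Lambda$ is the probability measure supported on the configurations $\phi\in\mathbb{Z}^{\mathbb{Z}}$ with $\phi_i=\omega_i$ for all $i\in\Lambda^c$, with weights $\mu_\Lambda^\omega(\phi)\propto\exp(-\beta H(\phi))$. Since $H$ is a formal infinite sum, this is understood via energy differences: the weight of $\phi$ is proportional to $$\exp\Big(-\beta\sum_{i\neq j:\ \{i,j\}\cap\Lambda\neq\emptyset}J_{ij}\big(V(\phi_i-\phi_j)-V(\bar\omega_i-\bar\omega_j)\big)\Big),$$ where the sum is over ordered pairs and $\bar\omega$ is the fixed reference configuration equal to $0$ on $\Lambda$ and to $\omega$ on $\Lambda^c$. The measure is defined for those $\omega$ for which these sums converge absolutely and the normalising constant (the sum of the weights over all such $\phi$) is finite. Gibbs measure: a probability measure $\mu$ on $\mathbb{Z}^{\mathbb{Z}}$ such that, for every $\Lambda\Subset\mathbb{Z}$, $\mu^\omega_\Lambda$ is well defined for $\mu$-almost every $\omega$ and the DLR equation $\mu(\cdot)=\int\mu(d\omega)\,\mu^\omega_\Lambda(\cdot)$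 holds. Shift-invariant: $\mu$ is invariant under all lattice translations $(\phi_i)_{i\in\mathbb{Z}}\mapsto(\phi_{i+v})_{i\in\mathbb{Z}}$, $v\in\mathbb{Z}$. *)

(* Defs.v *)
From HB Require Import structures.
From mathcomp Require Import all_boot all_order all_algebra.
From mathcomp Require Import all_classical all_reals all_analysis.

Set Implicit Arguments.
Unset Strict Implicit.
Unset Printing Implicit Defensive.

Import Order.TTheory GRing.Theory Num.Theory.
Import numFieldNormedType.Exports.

Local Open Scope classical_set_scope.
Local Open Scope ring_scope.

(* [g_sigma_algebraType] requires a pointed carrier; the point is irrelevant. *)
HB.instance Definition _ := isPointed.Build int 0.

(* As Z is countable with the discrete sigma-algebra, the product sigma-algebra
   on Z^Z is generated by the sets {phi | phi_i = x}. *)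
Definition cylinders : set (set (int -> int)) :=
  [set C | exists i x : int, C = [set phi | phi i = x]].

Definition config := g_sigma_algebraType cylinders.

(* Sum of an absolutely summable real family, as the difference of the sums of
   its positive and negative parts ([esum] only sums nonnegative families). *)
Definition abs_sum (R : realType) (T : choiceType) (D : set T) (f : T -> R) : R :=
  fine (\esum_(x in D) (Num.max (f x) 0)%:E) -
  fine (\esum_(x in D) (Num.max (- f x) 0)%:E).

Definition ref_config (L : set int) (w : config) : config :=
  fun i => if `[< L i >] then 0 else w i.

(* Ordered pairs. *)
Definition touching_pairs (L : set int) : set (int * int) :=
  [set ij | ij.1 != ij.2 /\ (L ij.1 \/ L ij.2)].

Definition energy_term (R : realType) (J : int -> int -> R) (V : int -> R)
    (L : set int) (w phi : config) (ij : int * int) : R :=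
  J ij.1 ij.2 *
  (V (phi ij.1 - phi ij.2) - V (ref_config L w ij.1 - ref_config L w ij.2)).

Definition boltzmann_weight (R : realType) (J : int -> int -> R) (V : int -> R)
    (beta : R) (L : set int) (w phi : config) : R :=
  expR (- beta * abs_sum (touching_pairs L) (energy_term J V L w phi)).

Definition compatible (L : set int) (w : config) : set config :=
  [set phi | forall i, ~ L i -> phi i = w i].

Definition partition_function (R : realType) (J : int -> int -> R)
    (V : int -> R) (beta : R) (L : set int) (w : config) : \bar R :=
  \esum_(phi in compatible L w) (boltzmann_weight J V beta L w phi)%:E.

Definition well_defined (R : realType) (J : int -> int -> R) (V : int -> R)
    (beta : R) (L : set int) (w : config) : Prop :=
  (forall phi, compatible L w phi ->
     summable (touching_pairs L) (fun ij => (energy_term J V L w phi ij)%:E)) /\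
  (partition_function J V beta L w < +oo)%E.

(* Set to 0 where undefined, so that w |-> finite_volume_measure .. w A is
   measurable; the Gibbs condition makes these w a null set. *)
Definition finite_volume_measure (R : realType) (J : int -> int -> R)
    (V : int -> R) (beta : R) (L : set int) (w : config) (A : set config) :
    \bar R :=
  if `[< well_defined J V beta L w >] then
    ((fine (partition_function J V beta L w))^-1%:E *
     \esum_(phi in A `&` compatible L w)
       (boltzmann_weight J V beta L w phi)%:E)%E
  else 0%E.

Definition gibbs (R : realType) (J : int -> int -> R) (V : int -> R) (beta : R)
    (mu : probability config R) : Prop :=
  forall L : set int, finite_set L ->
    {ae mu, forall w, well_defined J V beta L w} /\
    forall A : set config, measurable A ->
      mu A = (\int[mu]_w finite_volume_measure J V beta L w A)%E.

Definition shift (v : int) (phi : config) : config := fun i => phi (i + v).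

Definition shift_invariant (R : realType) (mu : probability config R) : Prop :=
  forall (v : int) (A : set config), measurable A -> mu (shift v @^-1` A) = mu A.

Definition shift_invariant_gibbs (R : realType) (J : int -> int -> R)
    (V : int -> R) (beta : R) : set (probability config R) :=
  [set mu | shift_invariant mu /\ gibbs J V beta mu].

(* Only evaluated at i <> j, so the value of Ja at 0 plays no role. *)
Definition coupling (R : realType) (Ja : nat -> R) (i j : int) : R :=
  Ja `|i - j|%N.

Definition potential (R : realType) (p : R) (x : int) : R :=
  `|x%:~R : R| `^ p.

(* Main.v *)
Require Import Defs.
From mathcomp Require Import all_boot all_order all_algebra.
From mathcomp Require Import all_classical all_reals all_analysis.
From mathcomp Require Import measurable_realfun ring lra zify.
Import Order.TTheory GRing.Theory Num.Theory.
Import numFieldNormedType.Exports.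
Local Open Scope classical_set_scope.
Local Open Scope ring_scope.

(** Let T add 1 to every spin of a block [0, n). As alpha > 2, the couplings
    across the boundary of the block have a total mass bounded uniformly in n,
    and V grows by at most a linear amount under unit increments; hence with a
    finite first moment the energy change caused by T has an expectation bounded
    uniformly in n, and by the DLR equation T distorts probabilities by a bounded
    factor outside an event of probability at most 1/4. On the other hand, the
    gap between the averages of phi over [0, n) and [n, 2n) is small in
    probability for a suitable n: for a bounded truncation of phi, the
    parallelogram identity writes the second moment of half the gap as
    a(n) - a(2n), where a(n), the second moment of the block average, is
    nonnegative, so that this difference is small for some dyadic n. But T
    increases the gap by exactly 1. *)

(** * Sums over countable index sets and integrals *)

Lemma esum_subset (R : realType) (T : choiceType) (A B : set T)
    (a : T -> \bar R) : A `<=` B ->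
  (\esum_(i in A) a i <= \esum_(i in B) a i)%E.
Proof.
move=> AB; apply: ereal_sup_le => _ [X [finX XA] <-] /=.
by exists X => //; split => //; exact: subset_trans AB.
Qed.

Lemma esum_setU_le (R : realType) (T : choiceType) (A B : set T)
    (a : T -> \bar R) : (forall x, 0 <= a x)%E ->
  (\esum_(i in A `|` B) a i <= \esum_(i in A) a i + \esum_(i in B) a i)%E.
Proof.
move=> a0; rewrite (esumID A)//; apply: leeD; apply: esum_subset.
  by move=> x [].
by move=> x [[]].
Qed.

(** As [e] may fail to be injective, a preimage [s j] is chosen for each point [j] of the image. The
    section [s] is injective there, so the left side is a sum over a subset of [P]. Its values lie
    in [option T], with [None] off the image, so that [T] may be empty. *)
Lemma esum_image_le (R : realType) (T T' : choiceType) (P : set T)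
    (e : T -> T') (a : T' -> \bar R) :
  (\esum_(j in e @` P) a j <= \esum_(i in P) a (e i))%E.
Proof.
have /choice[s sP] : forall j, exists oi,
    (e @` P) j -> exists2 i, oi = Some i & P i /\ e i = j.
  move=> j.
  have [[i Pi ij]|nj] := pselect ((e @` P) j); last by exists None.
  by exists (Some i) => _; exists i.
apply: (@le_trans _ _ (\esum_(o in s @` (e @` P)) oapp (a \o e) 0%E o)).
  rewrite (@esum_image _ _ _ _ s (oapp (a \o e) 0%E)).
    by apply: le_esum => j /sP[i -> [_ <-]].
  move=> j j'; rewrite !inE => /sP[i -> [_ <-]] /sP[i' -> [_ <-]].
  by move=> [->].
rewrite -(@esum_image _ _ _ P Some (oapp (a \o e) 0%E)).
  by apply: esum_subset => _ [_ /sP[i -> [Pi _]] <-]; exists i.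
by move=> ? ? _ _ [].
Qed.

(** Bridge from unordered sums to series over [nat], where measurability of the sum and exchange
    with the integral apply. Indices that code no element of [T] contribute 0. *)
Lemma nneseries_pickle (R : realType) (T : countType) (a : T -> \bar R) :
  (forall x, 0 <= a x)%E ->
  (\esum_(x in [set: T]) a x = \sum_(n <oo) oapp a 0 (pickle_inv n))%E.
Proof.
move=> a0; rewrite nneseries_esumT; last by move=> n; case: (@pickle_inv T n) => /=.
rewrite [RHS](esumID (range (@pickle T))); last first.
  by move=> n _; case: (@pickle_inv T n) => /=.
rewrite [X in (_ + X)%E]esum1 ?adde0; last first.
  move=> n [_ /=]; case: pickle_inv (@pickle_invK T n) => //= x xn /(_ _)[].
  by exists x.
rewrite setTI esum_image//.
by apply: eq_esum => x _; rewrite pickleK_inv.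
Qed.

Lemma esum_pickle (R : realType) (T : countType) (D : set T)
    (a : T -> \bar R) : (forall x, 0 <= a x)%E ->
  (\esum_(x in D) a x =
   \sum_(n <oo) oapp (fun x => if x \in D then a x else 0) 0 (pickle_inv n))%E.
Proof.
by move=> a0; rewrite esum_mkcond nneseries_pickle// => x; case: ifP.
Qed.

Lemma measurable_esum d (S : measurableType d) (R : realType) (T : countType)
    (D : set T) (f : T -> S -> \bar R) :
  (forall t, measurable_fun setT (f t)) -> (forall t w, 0 <= f t w)%E ->
  measurable_fun setT (fun w => \esum_(t in D) f t w)%E.
Proof.
move=> mf f0.
under eq_fun => w do rewrite esum_pickle//.
apply: ge0_emeasurable_sum => [n w _ _|n _].
  by case: (@pickle_inv T n) => //= t; case: (t \in D).
by case: (@pickle_inv T n) => //= t; case: (t \in D).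
Qed.

Lemma integral_esum d (S : measurableType d) (R : realType)
    (mu : {measure set S -> \bar R}) (T : countType)
    (D : set T) (f : T -> S -> \bar R) :
  (forall t, measurable_fun setT (f t)) -> (forall t w, 0 <= f t w)%E ->
  (\int[mu]_w (\esum_(t in D) f t w) = \esum_(t in D) \int[mu]_w f t w)%E.
Proof.
move=> mf f0.
under eq_integral => w _ do rewrite esum_pickle//.
rewrite esum_pickle; last by move=> t; exact: integral_ge0.
rewrite integral_nneseries//; first last.
- by move=> n w _; case: (@pickle_inv T n) => //= t; case: (t \in D).
- by move=> n; case: (@pickle_inv T n) => //= t; case: (t \in D).
apply: eq_eseriesr => n _; case: (@pickle_inv T n) => [t|] /=; last exact: integral0.
by case: ifP => // _; exact: integral0.
Qed.

Section le_integral_scale.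
Import HBNNSimple.

(* No measurability of [f] or [g] is required: the integral of a nonnegative
   function is a supremum over simple functions below it. *)
Lemma le_integral_scale d (S : measurableType d) (R : realType)
    (mu : {measure set S -> \bar R}) (c : R) (f g : S -> \bar R) :
  0 < c -> (forall w, 0 <= f w)%E -> (forall w, 0 <= g w)%E ->
  (forall w, f w <= c%:E * g w)%E ->
  (\int[mu]_w f w <= c%:E * \int[mu]_w g w)%E.
Proof.
move=> c0 f0 g0 fg; rewrite !ge0_integralTE//.
apply: ge_ereal_sup => _ [h /= hf <-].
have ic : 0 <= c^-1 by rewrite invr_ge0 ltW.
rewrite -lee_pdivrMl//.
pose h' : {nnsfun S >-> R} := scale_nnsfun h ic.
have -> : ((c^-1)%:E * sintegral mu h = sintegral mu h')%E.
  by rewrite -sintegralrM; apply: eq_sintegral.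
apply: ereal_sup_ubound; exists h' => //= w.
by rewrite EFinM lee_pdivrMl// (le_trans (hf w)).
Qed.

End le_integral_scale.

Lemma markov_ge0 d (S : measurableType d) (R : realType)
    (mu : {measure set S -> \bar R}) (c : R) (f : S -> \bar R) :
  0 < c -> measurable_fun setT f -> (forall w, 0 <= f w)%E ->
  (c%:E * mu [set w | c%:E <= f w] <= \int[mu]_w f w)%E.
Proof.
move=> c0 mf f0.
have fE w : `|f w|%E = f w by rewrite gee0_abs.
have -> : [set w | (c%:E <= f w)%E] = setT `&` [set w | (c%:E <= `|f w|)%E].
  by rewrite setTI; apply/seteqP; split => w /=; rewrite fE.
under eq_integral => w _ do rewrite -fE.
exact: (@le_integral_comp_abse _ _ _ mu setT measurableT f c id).
Qed.

(** * Energy cost of adding 1 on a finite set *)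

(** With negative parts moved across, the claim compares sums of nonnegative terms: termwise, g^+ +
    f^- <= f^+ + g^- + |g - f|. Summability makes all four sums finite, so they can be moved
    back. *)
Lemma abs_sum_sub_le (R : realType) (T : choiceType) (D : set T) (f g : T -> R)
    (K : R) :
  summable D (fun x => (f x)%:E) -> summable D (fun x => (g x)%:E) ->
  (\esum_(x in D) `|g x - f x|%:E <= K%:E)%E ->
  abs_sum D g - abs_sum D f <= K.
Proof.
have esum_fin (h : T -> R) : summable D (fun x => (h x)%:E) ->
    (\esum_(x in D) (Num.max (h x) 0)%:E)%E \is a fin_num.
  move=> sh; rewrite ge0_fin_numE.
    apply: le_lt_trans sh; apply: le_esum => x _ /=.
    by rewrite lee_fin ge_max normr_ge0 ler_norm.
  by apply: esum_ge0 => x _; rewrite lee_fin le_max lexx orbT.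
move=> sf sg gfK.
have sN (h : T -> R) : summable D (fun x => (h x)%:E) ->
    summable D (fun x => (- h x)%:E) by rewrite summableN.
have [fp fn gp gn] := And4 (esum_fin _ sf) (esum_fin _ (sN _ sf))
  (esum_fin _ sg) (esum_fin _ (sN _ sg)).
have m0 (x : R) : (0 <= (Num.max x 0)%:E)%E.
  by rewrite lee_fin le_max lexx orbT.
have : (\esum_(x in D) (Num.max (g x) 0)%:E +
        \esum_(x in D) (Num.max (- f x) 0)%:E <=
        \esum_(x in D) (Num.max (f x) 0)%:E +
        \esum_(x in D) (Num.max (- g x) 0)%:E + K%:E)%E.
  apply: le_trans (leeD2l _ gfK).
  rewrite -!esumD//; last by move=> x _; rewrite adde_ge0.
  apply: le_esum => x _; rewrite -!EFinD lee_fin.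
  have := ler_norm (g x - f x).
  case: (leP (g x) 0); case: (leP (f x) 0);
    case: (leP (- g x) 0); case: (leP (- f x) 0); lra.
rewrite /abs_sum -(fineK fp) -(fineK fn) -(fineK gp) -(fineK gn).
by rewrite -!EFinD lee_fin /=; lra.
Qed.

(** For a >= 1, (a + 1)^p = a^p (1 + 1/a)^p <= a^p + a^p (2/a + 1/a^2) since p <= 2, and then a^p <=
    a^2 bounds the last term by 2a + 1. *)
Lemma powR_succ_le (R : realType) (p : R) (m : nat) : 1 <= p <= 2 ->
  m.+1%:R `^ p <= m%:R `^ p + 3 * m%:R + 1.
Proof.
move=> /andP[p1 p2]; case: m => [|m].
  by rewrite powR1 mulr0 addr0 lerDr powR_ge0.
have : 1 <= m.+1%:R :> R by rewrite ler1n.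
rewrite -[m.+2%:R]natr1; move: (m.+1%:R : R) => a a1.
have a0 : 0 < a by exact: lt_le_trans a1.
have -> : a + 1 = a * (1 + a^-1).
  by rewrite mulrDr mulr1 divff ?gt_eqF.
have ia0 : 0 < a^-1 by rewrite invr_gt0.
rewrite powRM; [|exact: ltW|by rewrite addr_ge0// ltW].
have h1 : (1 + a^-1) `^ p <= (1 + a^-1) `^ 2%:R.
  by apply: ler_powR => //; rewrite lerDl ltW.
have h2 : a `^ p <= a `^ 2%:R by apply: ler_powR.
rewrite powR_mulrn in h1; last by lra.
rewrite powR_mulrn in h2; last by lra.
have ap0 : 0 <= a `^ p by exact: powR_ge0.
have h3 : a `^ p * (1 + a^-1) `^ p <= a `^ p * (1 + a^-1) ^+ 2.
  by rewrite ler_wpM2l.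
apply: (le_trans h3).
have -> : a `^ p * (1 + a^-1) ^+ 2 =
    a `^ p + a `^ p * (2 * a^-1 + a^-1 ^+ 2) by ring.
have h4 : a `^ p * (2 * a^-1 + a^-1 ^+ 2) <= a ^+ 2 * (2 * a^-1 + a^-1 ^+ 2).
  by rewrite ler_wpM2r// addr_ge0 ?mulr_ge0 ?sqr_ge0 ?ltW.
have h5 : a ^+ 2 * (2 * a^-1 + a^-1 ^+ 2) = 2 * a + 1.
  by field; rewrite gt_eqF.
lra.
Qed.

Lemma potential_increment (R : realType) (p : R) (x y : int) : 1 <= p <= 2 ->
  `|x - y| <= 1 -> `|potential p x - potential p y| <= 3 * (1 + `|x%:~R|).
Proof.
move=> hp xy; rewrite /potential -!intr_norm -!abszE.
have : (`|y| = `|x|.+1 \/ `|x| = `|y|.+1 \/ `|y| = `|x|)%N by lia.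
rewrite !(_ : forall n : nat, n%:Z%:~R = n%:R :> R)//.
move: `|x|%N `|y|%N => a b.
have mono (m : nat) : m%:R `^ p <= m.+1%:R `^ p :> R.
  by apply: ge0_ler_powR; rewrite ?nnegrE ?ler_nat//; lra.
have n0 (m : nat) : 0 <= m%:R :> R by [].
case=> [->|[->|->]].
- rewrite ler0_norm ?subr_le0//.
  by have := powR_succ_le R p a hp; have := n0 a; lra.
- rewrite ger0_norm ?subr_ge0//.
  by have := powR_succ_le R p b hp; have := n0 b; rewrite -natr1; lra.
by rewrite subrr normr0 mulr_ge0// addr_ge0.
Qed.

Lemma esumZ_le (R : realType) (T : choiceType) (D : set T) (c : R)
    (a : T -> \bar R) : 0 <= c -> (forall x, 0 <= a x)%E ->
  (\esum_(x in D) (c%:E * a x) <= c%:E * \esum_(x in D) a x)%E.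
Proof.
move=> c0 a0; apply: ge_ereal_sup => _ [X [finX XD] <-].
rewrite -ge0_mule_fsumr//; apply: lee_wpmul2l; first by rewrite lee_fin.
by apply: ereal_sup_ubound; exists X.
Qed.

Definition add_one (L : set int) (phi : config) : config :=
  fun i => if `[< L i >] then phi i + 1 else phi i.

Definition crossing_pairs (L : set int) : set (int * int) :=
  [set ij | (L ij.1 /\ ~ L ij.2) \/ (~ L ij.1 /\ L ij.2)].

(* Dominates the energy change caused by [add_one L]; possibly infinite. *)
Definition roughness {R : realType} (J : int -> int -> R) (L : set int)
    (phi : config) : \bar R :=
  \esum_(ij in crossing_pairs L)
    (`|J ij.1 ij.2| *
     (3 * (1 + `|(phi ij.1)%:~R| + `|(phi ij.2)%:~R|)))%:E.

Section finite_volume.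
Variables (R : realType) (J : int -> int -> R) (V : int -> R) (L : set int).
Hypothesis V_incr : forall x y : int,
  `|x - y| <= 1 -> `|V x - V y| <= 3 * (1 + `|x%:~R|).

(** The reference terms cancel. The difference phi i - phi j changes only if exactly one of i, j
    lies in [L]; it then moves by 1, and [V_incr] applies together with the triangle inequality. *)
Lemma energy_increment (w phi : config) (ij : int * int) :
  `|energy_term J V L w (add_one L phi) ij - energy_term J V L w phi ij| <=
  (if ij \in crossing_pairs L then `|J ij.1 ij.2| *
     (3 * (1 + `|(phi ij.1)%:~R| + `|(phi ij.2)%:~R|)) else 0).
Proof.
case: ij => i j; rewrite /energy_term /= -mulrBr opprB addrA subrK normrM.
have [|nC] := boolP ((i, j) \in crossing_pairs L); last first.
  rewrite (_ : add_one L phi i - add_one L phi j = phi i - phi j).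
    by rewrite subrr normr0 mulr0.
  move: nC; rewrite notin_setE /crossing_pairs /add_one /= => nC.
  case: asboolP => Li; case: asboolP => Lj; try lia.
  - by exfalso; apply: nC; left.
  - by exfalso; apply: nC; right.
rewrite inE => C; apply: ler_wpM2l => //; rewrite distrC.
apply: (@le_trans _ _ (3 * (1 + `|(phi i - phi j)%:~R|))).
  apply: V_incr; rewrite /add_one; case: asboolP => Li; case: asboolP => Lj; lia.
rewrite ler_pM2l// -addrA lerD2l intrB; exact: ler_normB.
Qed.

Lemma boltzmann_weight_add_one (beta K : R) (w phi : config) :
  0 < beta -> well_defined J V beta L w -> compatible L w phi ->
  (roughness J L phi <= K%:E)%E ->
  boltzmann_weight J V beta L w phi <=
  expR (beta * K) * boltzmann_weight J V beta L w (add_one L phi).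
Proof.
move=> b0 [sm _] cphi rK.
have cphi1 : compatible L w (add_one L phi).
  by move=> i Li; rewrite /add_one; case: asboolP => // _; exact: cphi.
rewrite /boltzmann_weight -expRD ler_expR.
have := @abs_sum_sub_le _ _ _ _ _ K (sm _ cphi) (sm _ cphi1).
move=> H; have {H} := H _; set a := abs_sum _ _; set b := abs_sum _ _ => H.
suff : a - b <= K by move=> /(ler_wpM2l (ltW b0)); rewrite mulrBr; lra.
apply: H; apply: le_trans rK.
rewrite /roughness [leRHS]esum_mkcond.
apply: (@le_trans _ _ (\esum_(ij in touching_pairs L)
    (if ij \in crossing_pairs L then (`|J ij.1 ij.2| *
     (3 * (1 + `|(phi ij.1)%:~R| + `|(phi ij.2)%:~R|)))%:E else 0)%E)).
  apply: le_esum => ij _; have := energy_increment w phi ij.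
  by case: ifP => _; rewrite lee_fin.
exact: esum_subset.
Qed.

Lemma finite_volume_measure_ge0 (beta : R) (w : config) (A : set config) :
  (0 <= finite_volume_measure J V beta L w A)%E.
Proof.
rewrite /finite_volume_measure; case: asboolP => // _.
apply: mule_ge0.
  rewrite lee_fin invr_ge0 fine_ge0// esum_ge0// => phi _.
  by rewrite lee_fin expR_ge0.
by apply: esum_ge0 => phi _; rewrite lee_fin expR_ge0.
Qed.

Lemma add_one_inj : injective (add_one L).
Proof.
move=> phi psi e; apply/funext => i.
by have := congr1 (@^~ i) e; rewrite /add_one; case: asboolP => // _ /addIr.
Qed.

(** The map [add_one L] is injective and fixes the spins outside [L], so it sends the compatible
    configurations of [A] injectively to those of [B], each weight dropping by at most the factor
    exp(beta K). Both sides share the normalising constant. *)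
Lemma finite_volume_measure_add_one (beta K : R) (w : config)
    (A B : set config) : 0 < beta ->
  (forall phi, A phi -> (roughness J L phi <= K%:E)%E /\ B (add_one L phi)) ->
  (finite_volume_measure J V beta L w A <=
   (expR (beta * K))%:E * finite_volume_measure J V beta L w B)%E.
Proof.
move=> b0 AB; rewrite /finite_volume_measure; case: asboolP => [wd|]; last first.
  by rewrite mule0.
rewrite muleCA; apply: lee_wpmul2l.
  rewrite lee_fin invr_ge0 fine_ge0// esum_ge0// => phi _.
  by rewrite lee_fin expR_ge0.
apply: (@le_trans _ _ (\esum_(phi in A `&` compatible L w)
   ((expR (beta * K))%:E * (boltzmann_weight J V beta L w (add_one L phi))%:E)%E)).
  apply: le_esum => phi [/AB[rK _] cphi].
  by rewrite -EFinM lee_fin; exact: boltzmann_weight_add_one.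
rewrite -(@esum_image _ _ _ _ (add_one L) (fun phi =>
  ((expR (beta * K))%:E * (boltzmann_weight J V beta L w phi)%:E)%E)); last first.
  by move=> ? ? _ _; exact: add_one_inj.
apply: (@le_trans _ _ (\esum_(phi in B `&` compatible L w)
   ((expR (beta * K))%:E * (boltzmann_weight J V beta L w phi)%:E)%E)).
  apply: esum_subset => _ [phi [/AB[_ Bphi] cphi] <-]; split=> // i Li.
  by rewrite /add_one; case: asboolP => // _; exact: cphi.
apply: esumZ_le; first exact: expR_ge0.
by move=> phi; rewrite lee_fin expR_ge0.
Qed.

End finite_volume.

(** The bound for a fixed boundary condition is integrated over that condition by the DLR
    equation. *)
Lemma gibbs_add_one (R : realType) (J : int -> int -> R) (V : int -> R)
    (beta K : R) (mu : probability config R) (L : set int) (A B : set config) :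
  (forall x y : int, `|x - y| <= 1 -> `|V x - V y| <= 3 * (1 + `|x%:~R|)) ->
  0 < beta -> gibbs J V beta mu -> finite_set L ->
  measurable A -> measurable B ->
  (forall phi, A phi -> (roughness J L phi <= K%:E)%E /\ B (add_one L phi)) ->
  (mu A <= (expR (beta * K))%:E * mu B)%E.
Proof.
move=> V_incr b0 G /G[_ dlr] mA mB AB; rewrite (dlr A)// (dlr B)//.
apply: le_integral_scale => [|w|w|w]; first exact: expR_gt0.
- exact: finite_volume_measure_ge0.
- exact: finite_volume_measure_ge0.
exact: (@finite_volume_measure_add_one _ _ _ _ V_incr).
Qed.

(** * Measurability on the configuration space *)

(** As Z is countable, the preimage of any set is a countable union of cylinders and empty sets,
    whatever [f] is. *)
Lemma measurable_coord (R : realType) (f : int -> R) (i : int) :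
  measurable_fun setT (fun phi : config => f (phi i)).
Proof.
move=> _ Y mY; rewrite setTI.
rewrite (_ : _ @^-1` Y =
  \bigcup_(x : int) [set phi : config | phi i = x /\ Y (f x)]).
  apply: countable_bigcupT_measurable => // x.
  have [Yx|nYx] := pselect (Y (f x)).
    by apply: sub_sigma_algebra; exists i, x; apply/seteqP; split => [phi []|].
  rewrite (_ : [set _ | _] = set0); first exact: measurable0.
  by apply/seteqP; split => [phi []|].
by apply/seteqP; split => [phi /= Yphi|phi [x _ [/= ->]]//]; exists (phi i).
Qed.

Lemma measurable_norm_coord (R : realType) (i : int) :
  measurable_fun setT (fun phi : config => `|(phi i)%:~R| : R).
Proof.
exact: (measurable_coord R (fun x => `|x%:~R|)).
Qed.

Lemma measurable_shift (v : int) : measurable_fun setT (Defs.shift v).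
Proof.
apply: (@measurability _ _ config config setT (Defs.shift v) cylinders) => //.
move=> _ [_ [i [x ->]] <-].
rewrite setTI; apply: sub_sigma_algebra; exists (i + v), x.
by [].
Qed.

Lemma measurable_roughness (R : realType) (J : int -> int -> R) (L : set int) :
  measurable_fun setT (roughness J L).
Proof.
apply: measurable_esum => [ij|ij phi].
  apply/measurable_EFinP; apply: measurable_funM => //.
  apply: measurable_funM => //; apply: measurable_funD; last first.
    exact: measurable_norm_coord.
  apply: measurable_funD => //.
  exact: measurable_norm_coord.
by rewrite lee_fin !(mulr_ge0, addr_ge0).
Qed.

(** * The boundary of a block *)

(** Discrete form of comparing b^(-t-1), where b = m + 2, with the integral of x^(-t-1) over
    [b - 1, b]. It is derived from exp x >= 1 + x, used once for ln (b - 1) - ln b <= -1/b and once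
    for the power. *)
Lemma powR_telescope (R : realType) (t : R) (m : nat) : 0 < t ->
  m.+2%:R `^ (- (t + 1)) <= t^-1 * (m.+1%:R `^ (- t) - m.+2%:R `^ (- t)).
Proof.
move=> t0; rewrite -[m.+2%:R]natr1.
have : 0 < m.+1%:R :> R by rewrite ltr0n.
move: (m.+1%:R : R) => a a0; set b := a + 1.
have b0 : 0 < b by rewrite addr_gt0.
rewrite ler_pdivlMl// opprD powRD; last by rewrite (gt_eqF b0) implybT.
rewrite powR_inv1; last exact: ltW.
have e1 : ln a - ln b <= - b^-1.
  rewrite -lnV// -lnM ?posrE ?invr_gt0// -ler_expR lnK ?posrE ?divr_gt0//.
  apply: le_trans (expR_ge1Dx _); rewrite ler_pdivrMr//.
  by rewrite mulrDl mulNr mulVf ?gt_eqF// /b; lra.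
have pw x : 0 < x -> x `^ (- t) = expR (- t * ln x).
  by move=> x0; rewrite /powR gt_eqF.
rewrite !pw//.
have -> : expR (- t * ln a) = expR (- t * ln b) * expR (t * (ln b - ln a)).
  by rewrite -expRD; congr expR; ring.
have e2 : 1 + t * b^-1 <= expR (t * (ln b - ln a)).
  apply: le_trans (expR_ge1Dx _).
  by rewrite lerD2l; apply: ler_wpM2l; [exact: ltW|lra].
have c0 := expR_ge0 (- t * ln b).
rewrite mulrCA lerBrDl -[X in X + _]mulr1 -mulrDr.
exact: ler_wpM2l.
Qed.

(** The convergent sequence k^alpha J(k) is bounded by some [M], so k |J(k)| <= M k^(-(t + 1)) with
    t = alpha - 2 > 0, and these powers telescope. The weight k counts the pairs at distance k that
    straddle a given boundary point. *)
Lemma esum_coupling_lty (R : realType) (alpha : R) (Ja : nat -> R) : 2 < alpha ->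
  k%:R `^ alpha * Ja k @[k --> \oo] --> (1 : R) ->
  exists C : R, (\esum_(k in [set: nat]) (k%:R * `|Ja k|)%:E <= C%:E)%E.
Proof.
move=> a2 hJ.
have [M [M0 MP]] : exists M : R, 0 <= M /\
    forall k : nat, `|k%:R `^ alpha * Ja k| <= M.
  have /cvg_seq_bounded : cvgn (fun k : nat => k%:R `^ alpha * Ja k).
    by apply/cvg_ex; exists 1.
  move=> [M [_ MP]]; exists (`|M| + 1); split => [|k]; first exact: addr_ge0.
  by apply: MP => //; rewrite (le_lt_trans (ler_norm M))// ltrDl.
have JM (k : nat) : k.+1%:R * `|Ja k.+1| <= M * k.+1%:R `^ (- ((alpha - 2) + 1)).
  have k0 : 0 < k.+1%:R `^ alpha :> R by rewrite powR_gt0// ltr0n.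
  have := MP k.+1; rewrite normrM (gtr0_norm k0).
  rewrite mulrC -ler_pdivlMr// => h.
  have -> : - (alpha - 2 + 1) = 1 - alpha by ring.
  rewrite powRD; last by rewrite pnatr_eq0 implybT.
  rewrite powRr1// powRN mulrCA.
  by apply: ler_wpM2l.
set t := alpha - 2 in JM.
have t0 : 0 < t by rewrite /t; lra.
exists (M * (1 + t^-1)).
rewrite -nneseries_esumT; last by move=> k; rewrite lee_fin mulr_ge0.
apply: lime_le.
  by apply: is_cvg_nneseries => k _ _; rewrite lee_fin mulr_ge0.
exists 2%N => // -[|[|n]] // _; rewrite /= sumEFin lee_fin.
(* The telescoped remainder is kept so that the induction closes. In the base case, k = 0
   contributes 0 and k = 1 at most [M]. *)
apply: (@le_trans _ _ (M * (1 + t^-1 * (1 - n.+1%:R `^ (- t))))); last first.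
  apply: ler_wpM2l => //; rewrite lerD2l ler_piMr//; first by rewrite invr_ge0 ltW.
elim: n => [|n IH].
  rewrite !big_nat_recr// big_nil /= mul0r !add0r powR1 subrr mulr0 addr0.
  by apply: le_trans (JM 0%N) _; rewrite powR1.
rewrite big_nat_recr//=; apply: (le_trans (lerD IH (JM n.+1))).
rewrite -mulrDr; apply: ler_wpM2l => //.
have := powR_telescope _ _ n t0; lra.
Qed.

(** The pair (m, l) stands for the sites -1 - m and l, at distance k = m + l + 1. It is determined
    by k and m < k, so each k occurs k times. *)
Lemma esum_half_line (R : realType) (a : nat -> \bar R) : (forall k, 0 <= a k)%E ->
  (\esum_(ml in [set: nat * nat]) a (ml.1 + ml.2).+1 <=
   \esum_(k in [set: nat]) (k%:R%:E * a k))%E.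
Proof.
move=> a0.
pose e (ml : nat * nat) := ((ml.1 + ml.2).+1, ml.1).
have e_inj : set_inj [set: nat * nat] e.
  by move=> [m l] [m' l'] _ _ []/= /[swap] -> /addnI ->.
rewrite -(@esum_image _ _ _ _ e (fun kl => a kl.1))//.
apply: (@le_trans _ _ (\esum_(kl in setT `*`` (fun k => `I_k)) a kl.1)).
  apply: esum_subset => _ [[m l] _ <-]; split => //=.
  by rewrite ltnS leq_addr.
rewrite -(@esum_esum _ _ _ _ (fun k => `I_k) (fun k _ => a k))//.
apply: le_esum => k _; rewrite esum_fset//.
rewrite -(@fsbig_ord _ _ _ k (fun=> a k)) sumr_const card_ord.
by rewrite mule_natl.
Qed.

Definition block (n : nat) : set int := [set i | 0 <= i < n%:Z].

Lemma finite_block (n : nat) : finite_set (block n).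
Proof.
apply: (@sub_finite_set _ _ (Posz @` `I_n)); last exact: finite_image.
by move=> i /= /andP[i0 iltn]; exists `|i|%N => /=; lia.
Qed.

(* A pair crossing the boundary of [0, n) straddles one of its two endpoints. *)
Lemma crossing_block_sub (n : nat) :
  let straddle (c : int) (ml : nat * nat) := (c - 1 - ml.1%:Z, c + ml.2%:Z) in
  let swap (ij : int * int) := (ij.2, ij.1) in
  crossing_pairs (block n) `<=`
    (range (straddle 0) `|` range (swap \o straddle 0)) `|`
    (range (straddle n%:Z) `|` range (swap \o straddle n%:Z)).
Proof.
move=> straddle swap.
have strad (c i j : int) : i < c <= j -> range (straddle c) (i, j).
  move=> /andP[ic cj]; exists (`|(c - 1 - i)%R|%N, `|(j - c)%R|%N) => //.
  by congr pair => /=; lia.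
have strad' (c i j : int) : i < c <= j -> range (swap \o straddle c) (j, i).
  by move=> /strad[ml _ h]; exists ml => //; rewrite /= h.
move=> [i j]; rewrite /crossing_pairs /block /= => ij.
have [h|[h|[h|h]]] : i < 0 <= j \/ j < 0 <= i \/ i < n%:Z <= j \/ j < n%:Z <= i.
  by lia.
- by left; left; exact: strad.
- by left; right; exact: strad'.
- by right; left; exact: strad.
- by right; right; exact: strad'.
Qed.

(** Four families cover the crossing pairs: two endpoints of the block, each with two orders of the
    pair. Each family costs at most [S], whatever the length of the block. *)
Lemma esum_crossing_block (R : realType) (a : nat -> \bar R) (S : \bar R)
    (n : nat) : (forall k, 0 <= a k)%E ->
  (\esum_(k in [set: nat]) (k%:R%:E * a k) <= S)%E ->
  (\esum_(ij in crossing_pairs (block n)) a `|ij.1 - ij.2|%N <=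
   S + S + (S + S))%E.
Proof.
move=> a0 aS.
have half (e : nat * nat -> int * int) :
    (forall ml, `|(e ml).1 - (e ml).2|%N = (ml.1 + ml.2).+1) ->
    (\esum_(ij in range e) a `|ij.1 - ij.2|%N <= S)%E.
  move=> eE; apply: le_trans aS; apply: le_trans (esum_half_line _ _ a0).
  apply: (le_trans (esum_image_le _ _ _ setT e (fun ij => a `|ij.1 - ij.2|%N))).
  by apply: le_esum => ml _; rewrite eE.
apply: (le_trans (esum_subset _ _ _ _ _ (@crossing_block_sub n))).
apply: (le_trans (esum_setU_le _ _ _ _ _ _)) => //.
by apply: leeD; apply: (le_trans (esum_setU_le _ _ _ _ _ _)) => //;
  apply: leeD; apply: half => -[m l] /=; lia.
Qed.

Lemma shift_invariant_integral (R : realType) (mu : probability config R)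
    (v : int) (h : config -> \bar R) : shift_invariant mu ->
  measurable_fun setT h -> (forall phi, 0 <= h phi)%E ->
  (\int[mu]_phi h (Defs.shift v phi) = \int[mu]_phi h phi)%E.
Proof.
move=> inv mh h0.
rewrite [RHS](eq_measure_integral (pushforward mu (Defs.shift v))).
- exact: measurable_shift.
- by move=> ms; rewrite ge0_integral_pushforward.
by move=> ms A mA _; exact/esym/inv.
Qed.

(** By Tonelli and shift invariance a pair contributes its |J| times 3 (1 + 2m), where m is the
    first absolute moment, and the crossing couplings have total mass at most 4C. The point is that
    the bound is the same for all n. *)
Lemma integral_roughness_le (R : realType) (alpha : R) (Ja : nat -> R)
    (mu : probability config R) :
  2 < alpha -> k%:R `^ alpha * Ja k @[k --> \oo] --> (1 : R) ->
  shift_invariant mu ->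
  (\int[mu]_phi `|(phi 0)%:~R : R|%:E < +oo)%E ->
  exists C : R, forall n,
    (\int[mu]_phi roughness (coupling Ja) (block n) phi <= C%:E)%E.
Proof.
move=> a2 hJ inv m_fin.
have [C CP] := esum_coupling_lty _ _ _ a2 hJ.
have coord i : (\int[mu]_phi `|(phi i)%:~R : R|%:E =
    \int[mu]_phi `|(phi 0)%:~R : R|%:E)%E.
  rewrite -[RHS](shift_invariant_integral _ mu i
    (fun phi => `|(phi 0)%:~R : R|%:E) inv).
  - by apply: eq_integral => phi _; rewrite /Defs.shift add0r.
  - by apply/measurable_EFinP; exact: measurable_norm_coord.
  - by move=> phi; rewrite lee_fin.
have m0 : (0 <= \int[mu]_phi `|(phi 0)%:~R : R|%:E)%E.
  by apply: integral_ge0 => phi _; rewrite lee_fin.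
have [m mE] : exists m, (\int[mu]_phi `|(phi 0)%:~R : R|%:E = m%:E)%E.
  exists (fine (\int[mu]_phi `|(phi 0)%:~R : R|%:E)%E).
  by rewrite fineK// ge0_fin_numE.
rewrite mE lee_fin in m0.
exists (3 * (1 + m + m) * (4 * C)) => n.
have mF (ij : int * int) : measurable_fun setT (fun phi : config =>
    1 + `|(phi ij.1)%:~R : R| + `|(phi ij.2)%:~R|).
  apply: measurable_funD; last exact: measurable_norm_coord.
  by apply: measurable_funD => //; exact: measurable_norm_coord.
have intF (ij : int * int) (c : R) : 0 <= c ->
    (\int[mu]_phi (c * (3 * (1 + `|(phi ij.1)%:~R| + `|(phi ij.2)%:~R|)))%:E =
     (3 * (1 + m + m))%:E * c%:E)%E.
  move=> c0.
  transitivity (\int[mu]_phi ((c * 3)%:E *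
      (1%:E + `|(phi ij.1)%:~R|%:E + `|(phi ij.2)%:~R|%:E)))%E.
    by apply: eq_integral => phi _; rewrite mulrA.
  have mN i : measurable_fun setT (fun phi : config => `|(phi i)%:~R : R|%:E).
    by apply/measurable_EFinP; exact: measurable_norm_coord.
  have m1 i : measurable_fun setT
      (fun phi : config => 1%:E + `|(phi i)%:~R : R|%:E)%E.
    by apply: emeasurable_funD.
  have d0 (x : R) : (0 <= 1%:E + `|x|%:E)%E by rewrite lee_fin addr_ge0.
  rewrite ge0_integralZl_EFin//; first last.
  - exact: mulr_ge0.
  - by apply: emeasurable_funD.
  - by move=> phi _; rewrite adde_ge0.
  rewrite ge0_integralD// ge0_integralD// !coord mE integral_cst//.
  rewrite [X in (1 * X)%E](_ : _ = 1%E) ?mule1; last exact: probability_setT.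
  by rewrite -!EFinD -!EFinM; congr EFin; ring.
rewrite /roughness integral_esum; first last.
- by move=> ij phi; rewrite lee_fin !(mulr_ge0, addr_ge0).
- move=> ij; apply/measurable_EFinP.
  by apply: measurable_funM => //; apply: measurable_funM.
under eq_esum => ij _ do rewrite intF//.
apply: (@le_trans _ _ ((3 * (1 + m + m))%:E *
   (\esum_(ij in crossing_pairs (block n)) `|Ja `|ij.1 - ij.2|%N|%:E))%E).
  apply: esumZ_le => [|x]; first by rewrite mulr_ge0// !addr_ge0.
  by rewrite lee_fin.
rewrite [leRHS]EFinM; apply: lee_wpmul2l.
  by rewrite lee_fin mulr_ge0// !addr_ge0.
have -> : (4 * C)%:E = (C%:E + C%:E + (C%:E + C%:E))%E.
  by rewrite -!EFinD; congr EFin; ring.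
by apply: (esum_crossing_block _ (fun k => `|Ja k|%:E)).
Qed.

(** * Block averages *)

Definition block_avg {R : realType} (f : int -> R) (c : int) (n : nat)
    (phi : config) : R :=
  n%:R^-1 * \sum_(i < n) f (phi (c + i%:Z)).

Definition block_gap {R : realType} (f : int -> R) (n : nat) (phi : config) : R :=
  block_avg f 0 n phi - block_avg f n%:Z n phi.

Lemma measurable_block_avg (R : realType) (f : int -> R) (c : int) (n : nat) :
  measurable_fun setT (block_avg f c n).
Proof.
apply: measurable_funM => //; apply: measurable_sum => i.
exact: measurable_coord.
Qed.

Lemma measurable_block_gap (R : realType) (f : int -> R) (n : nat) :
  measurable_fun setT (block_gap f n).
Proof. by apply: measurable_funB; exact: measurable_block_avg. Qed.

Lemma block_avg_shift (R : realType) (f : int -> R) (v : int) (n : nat)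
    (phi : config) : block_avg f v n phi = block_avg f 0 n (Defs.shift v phi).
Proof.
congr (_ * _); apply: eq_bigr => i _.
by rewrite /Defs.shift add0r addrC.
Qed.

Lemma block_avg_double (R : realType) (f : int -> R) (n : nat) (phi : config) :
  block_avg f 0 (n + n) phi = (block_avg f 0 n phi + block_avg f n%:Z n phi) / 2.
Proof.
rewrite /block_avg big_split_ord /= -mulrDr mulrAC.
rewrite (_ : (n + n)%:R^-1 = n%:R^-1 / 2 :> R); last first.
  by rewrite natrD -mulr2n -[n%:R *+ 2]mulr_natr invfM.
by congr (_ * (_ + _)); apply: eq_bigr.
Qed.

Lemma block_gap_add_one (R : realType) (n : nat) (phi : config) : (0 < n)%N ->
  block_gap (fun x => x%:~R : R) n (add_one (block n) phi) =
  block_gap (fun x => x%:~R) n phi + 1.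
Proof.
move=> n0; rewrite /block_gap /block_avg.
rewrite (eq_bigr (fun i : 'I_n => (phi (0 + i%:Z))%:~R + 1 : R)); last first.
  move=> i _; rewrite /add_one; case: asboolP; first by rewrite intrD.
  by case; rewrite /block /=; have := ltn_ord i; lia.
rewrite [X in _ - _ * X](eq_bigr
  (fun i : 'I_n => (phi (n%:Z + i%:Z))%:~R : R)); last first.
  move=> i _; rewrite /add_one; case: asboolP => //.
  by rewrite /block /=; lia.
rewrite big_split /= sumr_const card_ord mulrDr mulVf ?pnatr_eq0 -?lt0n//.
by rewrite addrAC.
Qed.

(** * Second moments of block averages of a bounded field *)

Section second_moment.
Variables (R : realType) (mu : probability config R) (f : int -> R) (M : R).
Hypotheses (inv : shift_invariant mu) (fM : forall x, `|f x| <= M).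

Let a (n : nat) := (\int[mu]_phi ((block_avg f 0 n phi) ^+ 2)%:E)%E.

Let mX2 c n : measurable_fun setT (fun phi => (block_avg f c n phi ^+ 2)%:E).
Proof.
apply/measurable_EFinP; apply: measurable_funX; exact: measurable_block_avg.
Qed.

Lemma block_avg_le (c : int) (n : nat) (phi : config) : `|block_avg f c n phi| <= M.
Proof.
have M0 : 0 <= M := le_trans (normr_ge0 _) (fM 0).
case: n => [|n]; first by rewrite /block_avg big_ord0 mulr0 normr0.
rewrite /block_avg normrM ger0_norm ?invr_ge0// ler_pdivrMl ?ltr0n//.
apply: (le_trans (ler_norm_sum _ _ _)).
apply: (@le_trans _ _ (\sum_(i < n.+1) M)); first exact: ler_sum.
by rewrite sumr_const card_ord mulr_natl.
Qed.

(* The parallelogram identity; shift invariance gives both blocks the same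
   second moment. *)
Lemma block_second_moment_double (n : nat) :
  (a (n + n) + \int[mu]_phi ((block_gap f n phi / 2) ^+ 2)%:E = a n)%E.
Proof.
rewrite /a -ge0_integralD//; first last.
- apply/measurable_EFinP; apply: measurable_funX; apply: measurable_funM => //.
  exact: measurable_block_gap.
- by move=> phi _; rewrite lee_fin sqr_ge0.
- by move=> phi _; rewrite lee_fin sqr_ge0.
transitivity (\int[mu]_phi ((2^-1)%:E * ((block_avg f 0 n phi ^+ 2)%:E +
    (block_avg f n%:Z n phi ^+ 2)%:E)))%E.
  apply: eq_integral => phi _; rewrite -!EFinD -EFinM; congr EFin.
  by rewrite block_avg_double /block_gap; field.
rewrite ge0_integralZl_EFin//; first last.
- by apply: emeasurable_funD.
- by move=> phi _; rewrite adde_ge0// lee_fin sqr_ge0.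
rewrite ge0_integralD//; try by move=> phi _; rewrite lee_fin sqr_ge0.
under [X in (_ * (_ + X))%E]eq_integral => phi _ do rewrite block_avg_shift.
rewrite (shift_invariant_integral _ mu n%:Z
  (fun phi => (block_avg f 0 n phi ^+ 2)%:E))//; last first.
  by move=> phi; rewrite lee_fin sqr_ge0.
have : (0 <= \int[mu]_phi (block_avg f 0 n phi ^+ 2)%:E)%E.
  by apply: integral_ge0 => phi _; rewrite lee_fin sqr_ge0.
(* Half of x + x is x in the extended reals, with x = +oo treated apart. *)
case: (\int[mu]_phi _)%E => [r _|_|//].
  by rewrite -EFinD -EFinM; congr EFin; field.
by rewrite addye// gt0_muley// lte_fin invr_gt0.
Qed.

(** Otherwise each doubling of the block would lower the second moment [a] by more than e/4, the 4
    coming from halving the gap. Starting from [a 1], which is at most M^2, it would become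
    negative. *)
Lemma exists_small_block_gap (e : R) : 0 < e ->
  exists2 n : nat, (0 < n)%N &
    (\int[mu]_phi ((block_gap f n phi) ^+ 2)%:E <= e%:E)%E.
Proof.
move=> e0; apply: contrapT => H.
have big k :
    ((e / 4)%:E < \int[mu]_phi ((block_gap f (2 ^ k) phi / 2) ^+ 2)%:E)%E.
  rewrite ltNge; apply/negP => le; apply: H.
  exists (2 ^ k)%N; first by rewrite expn_gt0.
  rewrite (eq_integral (fun phi =>
      4%:E * ((block_gap f (2 ^ k) phi / 2) ^+ 2)%:E)%E); last first.
    by move=> phi _; rewrite -EFinM; congr EFin; field.
  rewrite ge0_integralZl_EFin//; first last.
  - apply/measurable_EFinP; apply: measurable_funX; apply: measurable_funM => //.
    exact: measurable_block_gap.
  - by move=> phi _; rewrite lee_fin sqr_ge0.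
  rewrite muleC -lee_pdivlMr// -EFinM//.
have decr k : (a (2 ^ k) + (k%:R * (e / 4))%:E <= a 1)%E.
  elim: k => [|k IH]; first by rewrite expn0 mul0r adde0.
  apply: le_trans IH; rewrite -(block_second_moment_double (2 ^ k)).
  rewrite expnS mul2n -addnn -addeA leeD2l//.
  rewrite -natr1 mulrDl mul1r EFinD addeC leeD2r//.
  exact: ltW.
have a1 : (a 1 <= (M ^+ 2)%:E)%E.
  apply: (@le_trans _ _ (\int[mu]_phi (M ^+ 2)%:E)%E).
    apply: ge0_le_integral => //.
    - by move=> phi _; rewrite lee_fin sqr_ge0.
    - move=> phi _; rewrite lee_fin -real_normK ?num_real// ler_sqr ?nnegrE//.
        exact: block_avg_le.
      exact: le_trans (normr_ge0 _) (fM 0).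
  rewrite integral_cst// [X in (_ * X)%E](_ : _ = 1%E) ?mule1//.
  exact: probability_setT.
have [k kP] : exists k : nat, M ^+ 2 < k%:R * (e / 4).
  exists (Num.trunc (M ^+ 2 / (e / 4))).+1.
  by rewrite -ltr_pdivrMr ?divr_gt0// truncnS_gt.
have := le_trans (decr k) a1; rewrite leNgt => /negP; apply.
rewrite -[ltLHS]add0e; apply: lee_ltD => //.
- by apply: integral_ge0 => phi _; rewrite lee_fin sqr_ge0.
Qed.
End second_moment.

(** * From bounded to integrable fields *)

Lemma measurable_ge d (S : measurableType d) (R : realType) (f : S -> \bar R)
    (c : \bar R) : measurable_fun setT f -> measurable [set w | (c <= f w)%E].
Proof.
by move=> mf; rewrite -[X in measurable X]setTI; exact: emeasurable_fun_c_infty.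
Qed.

Definition truncate {R : realType} (k : nat) (x : int) : R :=
  if (`|x| <= k)%N then x%:~R else 0.

(** Dominated convergence: the error is at most |phi 0| and vanishes once k >= |phi 0|. *)
Lemma exists_small_tail (R : realType) (mu : probability config R) (e : R) :
  (\int[mu]_phi `|(phi 0)%:~R : R|%:E < +oo)%E -> 0 < e ->
  exists k, (\int[mu]_phi `|(phi 0)%:~R - truncate k (phi 0) : R|%:E <= e%:E)%E.
Proof.
move=> m_fin e0; apply: contrapT => H.
have big k : (e%:E <= \int[mu]_phi `|(phi 0)%:~R - truncate k (phi 0) : R|%:E)%E.
  by rewrite leNgt; apply/negP => /ltW le; apply: H; exists k.
have mt k : measurable_fun setT
    (fun phi : config => `|(phi 0)%:~R - truncate k (phi 0) : R|%:E).
  apply/measurable_EFinP.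
  exact: (measurable_coord R (fun x => `|x%:~R - truncate k x|)).
have : (\int[mu]_phi `|(phi 0)%:~R - truncate k (phi 0) : R|%:E)%E @[k --> \oo] -->
    (\int[mu]_phi cst 0 phi)%E.
  apply: (@dominated_cvg _ _ _ _ _ _ _ _
    (fun phi : config => `|(phi 0)%:~R : R|%:E)) => //.
  - move=> phi _; apply: cvg_near_cst; exists `|phi 0|%N => // k /= le.
    by rewrite /truncate le subrr normr0.
  - apply/integrableP; split.
      by apply/measurable_EFinP; exact: measurable_norm_coord.
    by under eq_integral => phi _ do rewrite abse_EFin normr_id.
  - move=> k phi _; rewrite abse_EFin normr_id lee_fin /truncate.
    by case: ifP => _; rewrite ?subrr ?normr0 ?subr0.
rewrite integral0 => cv0.
have : (e%:E <= limn (fun k =>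
    \int[mu]_phi `|(phi 0)%:~R - truncate k (phi 0) : R|%:E))%E.
  apply: lime_ge; first by apply/cvg_ex; exists 0%E.
  exact: nearW.
by rewrite (cvg_lim _ cv0)// lee_fin leNgt e0.
Qed.

(** The spin is split into a bounded truncation, whose gap is small in mean square for a suitable n,
    and a remainder [r], whose gap is small in mean for every n. The truncation level is therefore
    fixed before n. *)
Lemma exists_rigid_block (R : realType) (mu : probability config R) (e : R) :
  shift_invariant mu -> (\int[mu]_phi `|(phi 0)%:~R : R|%:E < +oo)%E -> 0 < e ->
  exists2 n : nat, (0 < n)%N &
    (mu [set phi | (1 / 2 <= `|block_gap (fun x => x%:~R : R) n phi|)%R] <= e%:E)%E.
Proof.
move=> inv m_fin e0.
(* The remainder costs e/64 per site, hence e/32 for the gap between two averages. With e/64 for the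
   truncated part, the mean of [h] is at most e/16, and Markov's inequality at level 1/16 gives
   e. *)
have d0 : 0 < e / 64 by rewrite divr_gt0.
have [k kP] := exists_small_tail _ _ _ m_fin d0.
pose r (x : int) : R := x%:~R - truncate k x.
have trM (x : int) : `|truncate k x : R| <= k%:R.
  rewrite /truncate; case: ifP => h; last by rewrite normr0.
  by rewrite -intr_norm -abszE ler_nat.
have [n n0 nP] := exists_small_block_gap _ _ _ _ inv trM _ d0.
exists n => //.
pose h (phi : config) := (block_gap (truncate k) n phi) ^+ 2 + `|block_gap r n phi|.
have gapE phi : block_gap (fun x => x%:~R : R) n phi =
    block_gap (truncate k) n phi + block_gap r n phi.
  have avgE c : block_avg (fun x => x%:~R : R) c n phi =
      block_avg (truncate k) c n phi + block_avg r c n phi.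
    rewrite /block_avg -mulrDr -big_split; congr (_ * _); apply: eq_bigr => i _.
    by rewrite /= /r addrCA subrr addr0.
  by rewrite /block_gap !avgE; ring.
have int_r (i : int) : (\int[mu]_phi `|r (phi i)|%:E <= (e / 64)%:E)%E.
  apply: le_trans kP. 
  rewrite -[X in (_ <= X)%E](shift_invariant_integral _ mu i
    (fun phi => `|r (phi 0)|%:E))//.
  - by under [leRHS]eq_integral => phi _ do rewrite /Defs.shift add0r.
  - by apply/measurable_EFinP; exact: (measurable_coord R (fun x => `|r x|)).
have mr i : measurable_fun setT (fun phi : config => `|r (phi i)|%:E).
  by apply/measurable_EFinP; exact: (measurable_coord R (fun x => `|r x|)).
have mg2 : measurable_fun setT
    (fun phi => (block_gap (truncate k) n phi ^+ 2 : R)%:E).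
  by apply/measurable_EFinP; apply: measurable_funX; exact: measurable_block_gap.
have mgr : measurable_fun setT (fun phi => `|block_gap r n phi|%:E).
  apply/measurable_EFinP.
  exact: (measurableT_comp (@normr_measurable R setT) (measurable_block_gap R r n)).
have mh : measurable_fun setT (fun phi => (h phi)%:E).
  exact: (emeasurable_funD mg2 mgr).
have n_gt0 : 0 < n%:R :> R by rewrite ltr0n.
have int_gap_r : (\int[mu]_phi `|block_gap r n phi|%:E <= (e / 32)%:E)%E.
  apply: (@le_trans _ _ (\int[mu]_phi ((n%:R^-1)%:E *
      \sum_(i < n) (`|r (phi i%:Z)|%:E + `|r (phi (n%:Z + i%:Z))|%:E)))%E).
    apply: ge0_le_integral => //.
    - apply: measurable_funeM; apply: emeasurable_sum => i.
      by apply: emeasurable_funD.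
    - move=> phi _; under eq_bigr do rewrite -EFinD.
      rewrite sumEFin -EFinM lee_fin /block_gap /block_avg -mulrBr normrM.
      rewrite ger0_norm ?invr_ge0// ler_pM2l ?invr_gt0//.
      apply: (le_trans (ler_normB _ _)); rewrite [leRHS]big_split /=; apply: lerD.
        apply: (le_trans (ler_norm_sum _ _ _)).
        by apply: ler_sum => i _; rewrite add0r.
      exact: ler_norm_sum.
  rewrite ge0_integralZl_EFin//; first last.
  - by apply: emeasurable_sum => i; apply: emeasurable_funD.
  - by move=> phi _; apply: sume_ge0 => i _; rewrite adde_ge0.
  rewrite ge0_integral_sum//; first last.
  - by move=> i phi _; rewrite adde_ge0.
  - by move=> i; apply: emeasurable_funD.
  rewrite lee_pdivrMl//.
  apply: (@le_trans _ _ (\sum_(i < n) (e / 32)%:E)%E).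
    apply: lee_sum => i _; rewrite ge0_integralD//.
    apply: (le_trans (leeD (int_r _) (int_r _))).
    by rewrite -EFinD lee_fin; lra.
  by rewrite sumEFin sumr_const card_ord -EFinM lee_fin mulr_natl.
have int_h : (\int[mu]_phi (h phi)%:E <= (e / 16)%:E)%E.
  under eq_integral => phi _ do rewrite EFinD.
  rewrite ge0_integralD//; last by move=> phi _; rewrite lee_fin sqr_ge0.
  apply: (le_trans (leeD nP int_gap_r)).
  by rewrite -EFinD lee_fin; lra.
have c0 : 0 < 1 / 16 :> R by rewrite divr_gt0.
have h0 phi : (0 <= (h phi)%:E)%E by rewrite lee_fin addr_ge0// sqr_ge0.
have := le_trans (markov_ge0 _ _ _ mu _ _ c0 mh h0) int_h.
rewrite -lee_pdivlMl// => le.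
apply: (@le_trans _ _ (((1 / 16)^-1)%:E * (e / 16)%:E)%E); last first.
  by rewrite -EFinM lee_fin; lra.
apply: le_trans le; apply: le_measure; rewrite ?inE.
- under eq_set => phi do rewrite -lee_fin.
  apply: measurable_ge; apply/measurable_EFinP.
  exact: (measurableT_comp (@normr_measurable R setT) (measurable_block_gap R _ n)).
- exact: measurable_ge.
move=> phi /=; rewrite gapE lee_fin /h => big.
(* If the full gap is at least 1/2, one of the two parts is at least 1/4 in absolute value; either
   way [h] is at least 1/16. *)
have [h1|h1] := leP (1 / 4) `|block_gap r n phi|.
  by have := sqr_ge0 (block_gap (truncate k) n phi : R); lra.
have := ler_normD (block_gap (truncate k) n phi) (block_gap r n phi) => h2.
have h3 : 1 / 4 <= `|block_gap (truncate k) n phi : R| by lra.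
have := normr_ge0 (block_gap r n phi).
rewrite -[_ ^+ 2]real_normK ?num_real//.
by nra.
Qed.

(** * The contradiction *)

(** Let [B] be the event of a gap of at least 1/2, and [Q] that of a roughness of at least [K]. Off
    both events, adding 1 on the block leads into [B] at a cost [E] in probability. Hence 1 <= E
    mu(B) + mu(B) + mu(Q), whereas the right side is at most 3/4. *)
Lemma no_integrable_shift_invariant_gibbs (R : realType) (alpha beta p : R)
    (Ja : nat -> R) (mu : probability config R) :
  2 < alpha -> 0 < beta -> 1 <= p <= 2 ->
  k%:R `^ alpha * Ja k @[k --> \oo] --> (1 : R) ->
  shift_invariant_gibbs (coupling Ja) (potential p) beta mu ->
  ~ (\int[mu]_phi `|(phi 0)%:~R : R|%:E < +oo)%E.
Proof.
move=> a2 b0 hp hJ [inv G] m_fin.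
have [C CP] := integral_roughness_le _ _ _ _ a2 hJ inv m_fin.
(* Markov's inequality then gives mu(Q) <= C/K <= 1/4; the form |C| + 1 makes [K] positive whatever
   the sign of [C]. *)
pose K := 4 * (`|C| + 1).
have K0 : 0 < K by rewrite mulr_gt0// ltr_wpDl.
pose E := expR (beta * K).
have E0 : 0 < E by exact: expR_gt0.
(* Since [C], and so [E], is independent of n, this tolerance can be fixed before n is chosen. It
   yields (1 + E) mu(B) <= 1/2. *)
have e0 : 0 < (2 * (1 + E))^-1 by rewrite invr_gt0 mulr_gt0// addr_gt0.
have [n n0 nP] := exists_rigid_block _ _ _ inv m_fin e0.
pose rough := roughness (coupling Ja) (block n).
have mrough : measurable_fun setT rough by exact: measurable_roughness.
set B := [set phi | _] in nP.
have mB : measurable B.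
  rewrite /B; under eq_set => phi do rewrite -lee_fin.
  apply: measurable_ge; apply/measurable_EFinP.
  exact: (measurableT_comp (@normr_measurable R setT) (measurable_block_gap R _ n)).
pose Q := [set phi : config | (K%:E <= rough phi)%E].
have mQ : measurable Q by exact: measurable_ge.
have muQ : (mu Q <= (1 / 4)%:E)%E.
  have rough0 phi : (0 <= rough phi)%E.
    by apply: esum_ge0 => ij _; rewrite lee_fin !(mulr_ge0, addr_ge0).
  have := le_trans (markov_ge0 _ _ _ mu _ _ K0 mrough rough0) (CP n).
  rewrite -lee_pdivlMl// => /le_trans; apply.
  rewrite -EFinM lee_fin ler_pdivrMl// /K.
  by have := ler_norm C; lra.
pose A := ~` (B `|` Q).
have mA : measurable A by apply: measurableC; exact: measurableU.
have muA : (mu A <= E%:E * mu B)%E.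
  apply: (gibbs_add_one _ _ _ _ _ _ _ _ _ _ b0 G (finite_block n)) => //.
    by move=> x y; exact: potential_increment.
  move=> phi /not_orP[nB nQ]; split.
    by move: nQ => /negP; rewrite -ltNge => /ltW.
  (* The old gap exceeds -1/2, so the new one exceeds 1/2. *)
  move: nB; rewrite /B /= block_gap_add_one// => /negP; rewrite -ltNge => nB.
  have := ler_norm (block_gap (fun x => x%:~R : R) n phi + 1).
  have := ler_norm (- block_gap (fun x => x%:~R : R) n phi).
  by rewrite normrN; lra.
have : (1%:E <= E%:E * mu B + (mu B + (1 / 4)%:E))%E.
  have <- : mu setT = 1%:E by exact: probability_setT.
  rewrite -(setvU (B `|` Q)).
  apply: (le_trans (measureU2 _ _ _)) => //; first exact: measurableU.
  apply: leeD => //; apply: (le_trans (measureU2 _ _ _)) => //.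
  exact: leeD.
rewrite leNgt => /negP; apply.
apply: (@le_lt_trans _ _ (E * (2 * (1 + E))^-1 + ((2 * (1 + E))^-1 + 1 / 4))%:E).
  rewrite !EFinD; apply: leeD; last exact: leeD.
  by rewrite EFinM; apply: lee_wpmul2l => //; rewrite lee_fin ltW.
rewrite lte_fin.
have -> : E * (2 * (1 + E))^-1 + ((2 * (1 + E))^-1 + 1 / 4) = 3 / 4.
  by field; rewrite gt_eqF// addr_gt0.
by lra.
Qed.

Theorem theorem1 (R : realType) (alpha beta p : R) (Ja : nat -> R)
    (halpha : 2 < alpha) (hbeta : 0 < beta) (hp : 1 <= p <= 2)
    (hJ : k%:R `^ alpha * Ja k @[k --> \oo] --> (1 : R)) :
  (p = 1 \/ p = 2 ->
     ~ exists mu : probability config R,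
         shift_invariant_gibbs (coupling Ja) (potential p) beta mu /\
         ('E_mu[fun phi : config => `|(phi 0)%:~R : R|%R] < +oo)%E) /\
  (1 < p < 2 ->
     ~ exists mu : probability config R,
         shift_invariant_gibbs (coupling Ja) (potential p) beta mu /\
         ('E_mu[fun phi : config => ((phi 0)%:~R ^+ 2 : R)%R] < +oo)%E).
Proof.
split=> [_|_] [mu [G]]; rewrite unlock => m_fin;
  apply: (no_integrable_shift_invariant_gibbs _ _ _ _ _ _ halpha hbeta hp hJ G) => //.
(* What remains is the second moment case: |x| <= x^2 for integers, so the first moment is finite as
   well. *)
apply: le_lt_trans m_fin; apply: ge0_le_integral => //.
- by apply/measurable_EFinP; exact: measurable_norm_coord.
- by apply/measurable_EFinP; exact: (measurable_coord R (fun x => x%:~R ^+ 2)).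
move=> phi _; rewrite lee_fin -rmorphXn -intr_norm ler_int /=.
by move: (phi 0 : int) => x; rewrite expr2; nia.
Qed.
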